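(* Suppose that for all positive integers $m$ and $\ell$ with $\ell\ge 2m+1$ we have $f_{C_\ell}(m,m)=m$, where $C_\ell$ is the cycle on $\ell$ vertices. Then for every positive integer $n$ and every finite graph $G$ of maximum degree at most two with $c_e(G)\le 4$ and such that $G$ has at least one independent set of size $n$, we have $f_G(n,n-1)=n-1$.
   Context: For a collection $\mathcal{F}=(F_1,\dots,F_k)$ of sets (not necessarily distinct), a rainbow set of $\mathcal{F}$ is a set $\{x_{i_1},\dots,x_{i_m}\}$ of $m$ distinct elements with $i_1<\dots<i_m$ distinct indices in $[k]$ and $x_{i_j}\in F_{i_j}$. Given a graph $G$ and a collection $\mathcal{F}$ of independent sets of $G$, a rainbow independent set of $(\mathcal{F},G)$ is a rainbow set of $\mathcal{F}$ that is also independent in $G$; an $m$-set is a set of size $m$. For integers $m\le n$, $f_G(n,m)$ is the minimal number $k$ such that every collection of $k$ (not necessarily distinct) independent $n$-sets of $G$ has a rainbow independent $m$-set. $c_e(G)$ denotes the number of connected components of $G$ that are isomorphic to cycles of even length. *)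

(* Defs.v *)
(* A finite simple graph is given by a finType T of vertices and a
   symmetric irreflexive adjacency relation e : rel T. *)
From HB Require Import structures.
From mathcomp Require Import all_boot.

Set Implicit Arguments.
Unset Strict Implicit.
Unset Printing Implicit Defensive.

Definition max_degree (T : finType) (e : rel T) : nat :=
  \max_(x : T) #|[set y | e x y]|.

Definition independent (T : finType) (e : rel T) (A : {set T}) : Prop :=
  {in A &, forall x y, ~~ e x y}.

(* The cycle C_l; it is a simple graph only for 3 <= l. *)
Definition cycle_graph (l : nat) : rel 'I_l :=
  [rel i j | (val j == (val i).+1 %% l) || (val i == (val j).+1 %% l)].

Definition components (T : finType) (e : rel T) : {set {set T}} :=
  equivalence_partition (connect e) [set: T].

(* The subgraph of (T, e) induced on A is isomorphic to (T', e'). *)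
Definition induced_iso (T : finType) (e : rel T) (A : {set T})
    (T' : finType) (e' : rel T') : bool :=
  [exists f : {ffun T' -> T},
    [&& injectiveb f, f @: [set: T'] == A &
        [forall i, forall j, e (f i) (f j) == e' i j]]].

(* The length of a cycle isomorphic to the subgraph induced on A is #|A|. *)
Definition is_even_cycle (T : finType) (e : rel T) (A : {set T}) : bool :=
  [&& 3 <= #|A|, ~~ odd #|A| & induced_iso e A (@cycle_graph #|A|)].

Definition c_e (T : finType) (e : rel T) : nat :=
  #|[set A in components e | is_even_cycle e A]|.

Definition rainbow (T : finType) (k : nat) (F : 'I_k -> {set T})
    (X : {set T}) : Prop :=
  exists (m : nat) (i : 'I_m -> 'I_k) (x : 'I_m -> T),
    [/\ forall a b : 'I_m, a < b -> i a < i b,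
        injective x,
        forall a, x a \in F (i a) &
        X = [set x a | a : 'I_m]].

Definition forces_rainbow (T : finType) (e : rel T) (n m k : nat) : Prop :=
  forall F : 'I_k -> {set T},
    (forall i, independent e (F i) /\ #|F i| = n) ->
    exists X : {set T}, [/\ rainbow F X, independent e X & #|X| = m].

(* f_is e n m k states f_G(n, m) = k for G = (T, e).  For m <= n such a k
   always exists: in a long enough collection some n-set occurs n times. *)
Definition f_is (T : finType) (e : rel T) (n m k : nat) : Prop :=
  forces_rainbow e n m k /\
  forall k' : nat, forces_rainbow e n m k' -> k <= k'.

(* Main.v *)
(* Let X index N independent sets of size N + 1.  A union K of components can be
   split off whenever some k of the sets have a full rainbow independent set in
   K and every other set meets K in at most k vertices: the remaining N - k sets
   still have at least N - k + 1 vertices outside K.  Taking k maximal such that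
   k sets meet K in at least k vertices, this disposes of every acyclic
   component (greedy choice), of odd cycles and, through the hypothesis on cycles,
   of an even cycle with 2 s vertices unless between s and 2 s - 2 of the sets meet
   it in s vertices.

   With at most four such tight cycles left, let u_j = s_j - 1 and let a_ij <=
   u_j + 1 be the number of vertices of the i-th set on the j-th cycle.  It suffices
   to assign each i to a cycle j so that each class has size at most u_j and at
   most a_ij for its members i.  Counting the pairs with a_ij = u_j + 1 gives
   N <= u_1 + u_2 + u_3 + u_4.  The indices obstructing the strategy "fill cycles 1
   and 2 first" are disjoint from those obstructing "fill cycles 3 and 4 first",
   so one of the two strategies can absorb all of its obstructing indices. *)
Require Import Defs.
From HB Require Import structures.
From mathcomp Require Import all_boot.
From mathcomp Require Import zify.

Set Implicit Arguments.
Unset Strict Implicit.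
Unset Printing Implicit Defensive.

(** * Assigning rows to four columns *)

Lemma subset_between (I : finType) (A B : {set I}) (k : nat) :
  A \subset B -> #|A| <= k -> k <= #|B| ->
  exists Y : {set I}, [/\ A \subset Y, Y \subset B & #|Y| = k].
Proof.
move=> sAB; elim: k => [|k IHk] Ak kB.
  by exists A; split=> //; apply/eqP; rewrite -leqn0.
have [Ak'|Ak'] := leqP #|A| k; last first.
  by exists A; split=> //; apply/eqP; rewrite eqn_leq Ak Ak'.
have [Y [sAY sYB cY]] := IHk Ak' (ltnW kB).
have /properP[_ [x xB xY]] : Y \proper B.
  by rewrite properEcard sYB cY.
exists (x |: Y); split; last by rewrite cardsU1 xY cY.
- by rewrite (subset_trans sAY) // subsetUr.
- by rewrite subUset sub1set xB.
Qed.

(** [#|Y|] is the largest [x <= u] such that at least [x] rows have value at least [x]. The rows of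
    [P] are forced into [Y], which is possible because their values reach the cap [u]. *)
Lemma greedy_class (I : finType) (X P : {set I}) (a : I -> nat) (u : nat) :
  P \subset [set i in X | u <= a i] -> #|P| <= u ->
  exists Y : {set I}, [/\ Y \subset X, P \subset Y, #|Y| <= u,
    {in Y, forall i, #|Y| <= a i} &
    {in X :\: Y, forall i, minn (a i) u <= #|Y|}].
Proof.
move=> sP cP.
pose L k := [set i in X | k <= a i].
have ex0 : exists k, (k <= #|L k|) && (k <= u) by exists 0.
have bd k : (k <= #|L k|) && (k <= u) -> k <= u by case/andP.
case: (ex_maxnP ex0 bd) => x /andP[xL xu] xmax.
have [xu'|xu'] := eqVneq x u.
  rewrite xu' in xL; have [Y [sPY sYL cY]] := subset_between sP cP xL.
  exists Y; rewrite cY; split=> //.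
  - by apply: subset_trans sYL _; apply/subsetP=> i; rewrite inE => /andP[].
  - by move=> i /(subsetP sYL); rewrite inE => /andP[].
  - by move=> i _; rewrite geq_minr.
have x1u : x.+1 <= u by rewrite ltn_neqAle xu' xu.
(* By maximality of [x] all rows of value above [x] fit into a class of size [x], so a row left out
   has value at most [x]. *)
have Lx1 : #|L x.+1| <= x.
  rewrite leqNgt; apply/negP => h.
  by have := xmax x.+1; rewrite h x1u ltnn => /(_ isT).
have sL : L x.+1 \subset L x.
  by apply/subsetP => i; rewrite !inE => /andP[-> /ltnW].
have [Y [sPY sYL cY]] := subset_between sL Lx1 xL.
exists Y; rewrite cY; split=> //.
- by apply: subset_trans sYL _; apply/subsetP=> i; rewrite inE => /andP[].
- apply: subset_trans sPY; apply: subset_trans sP _.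
  apply/subsetP=> i; rewrite !inE => /andP[-> h]; exact: leq_trans h.
- by move=> i /(subsetP sYL); rewrite inE => /andP[].
- move=> i /setDP[iX iY]; rewrite geq_min; apply/orP; left.
  rewrite leqNgt; apply: contra iY => h; apply: (subsetP sPY).
  by rewrite inE iX.
Qed.

Section Assignment.
Variables (I : finType) (X : {set I}) (u1 u2 u3 u4 : nat).
Variables (a1 a2 a3 a4 : I -> nat).

(** The classes may overlap, since [rainbow_onU] resolves ties. The last four conditions provide the
    traces that the hypothesis on cycles asks for. *)
Definition assignable : Prop :=
  exists Y1 Y2 Y3 Y4 : {set I},
  [/\ X \subset Y1 :|: Y2 :|: Y3 :|: Y4, Y1 \subset X /\ Y2 \subset X,
      Y3 \subset X /\ Y4 \subset X,
   [/\ #|Y1| <= u1, #|Y2| <= u2, #|Y3| <= u3 & #|Y4| <= u4] &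
   [/\ {in Y1, forall i, #|Y1| <= a1 i},
       {in Y2, forall i, #|Y2| <= a2 i},
       {in Y3, forall i, #|Y3| <= a3 i} &
       {in Y4, forall i, #|Y4| <= a4 i}]].

(* If columns 1 and 2 take u1 and u2 rows, these are the rows whose entries in
   columns 3 and 4, cut off at u3 and u4, sum to less than the number of
   remaining rows. *)
Definition shortage : {set I} :=
  [set i in X | 2 + (u1 - a1 i) + (u2 - a2 i) <=
     (a1 i - u1) + (a2 i - u2) + (a3 i - u3) + (a4 i - u4)].

(** Column 1 gets exactly [u1] rows, columns 2 and 3 are filled greedily and column 4 takes the
    rest. Shortage rows can go to either of columns 1 and 2, which absorb all of them; the other
    rows still fit in columns 3 and 4. *)
Lemma half_assignment :
  {in X, forall i, [/\ a1 i <= u1.+1, a2 i <= u2.+1, a3 i <= u3.+1 & a4 i <= u4.+1]} ->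
  {in X, forall i, a1 i + a2 i + a3 i + a4 i = #|X|.+1} ->
  #|X| <= u1 + u2 + u3 + u4 ->
  u1 <= #|[set i in X | u1 <= a1 i]| ->
  u2 <= #|[set i in X | u2 <= a2 i]| ->
  #|shortage| <= u1 + u2 ->
  assignable.
Proof.
move=> ha hs hN hn1 hn2 hP.
set near1 := [set i in X | u1 <= a1 i] in hn1.
set near2 := [set i in X | u2 <= a2 i] in hn2.
(* A shortage row with [a1 i < u1] would have excess 1 in the three other columns and deficit 1
   here, so [#|X| = u1 + u2 + u3 + u4 + 1], against [hN]. *)
have sP1 : shortage \subset near1.
  apply/subsetP=> i; rewrite !inE => /andP[iX].
  by rewrite iX /=; have [] := ha i iX; have := hs i iX; lia.
have sP2 : shortage \subset near2.
  apply/subsetP=> i; rewrite !inE => /andP[iX].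
  by rewrite iX /=; have [] := ha i iX; have := hs i iX; lia.
(* [P1] consists of the shortage rows for which column 2 has no room. *)
have [P1 [_ sP1P cP1]] : exists Y : {set I},
    [/\ set0 \subset Y, Y \subset shortage & #|Y| = #|shortage| - u2].
  by apply: subset_between; rewrite ?sub0set ?cards0 ?leq_subr.
(* After [P1], column 1 prefers rows outside [near2], so as to leave the rows of [near2] to column
   2. *)
have [A [sP1A sAn cA alt]] : exists A : {set I},
  [/\ P1 \subset A, A \subset near1, #|A| = u1 &
    near1 :\: near2 \subset A \/ A :&: near2 \subset P1].
  have sWn : P1 :|: (near1 :\: near2) \subset near1.
    by rewrite subUset subsetDl (subset_trans sP1P).
  have [hW|hW] := leqP u1 #|P1 :|: (near1 :\: near2)|.
  - have [|||A [s1 s2 s3]] := @subset_between _ P1 (P1 :|: (near1 :\: near2)) u1.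
    + exact: subsetUl.
    + by rewrite cP1; lia.
    + exact: hW.
    exists A; split=> //; first exact: subset_trans sWn.
    right; apply/subsetP=> i /setIP[/(subsetP s2)].
    by rewrite !inE => /orP[//|/andP[h _]] h2; case/negP: h.
  - have [|||A [s1 s2 s3]] := @subset_between _ (P1 :|: (near1 :\: near2)) near1 u1.
    + by [].
    + exact: ltnW.
    + exact: hn1.
    by exists A; split=> //; [|left]; apply: subset_trans s1; rewrite ?subsetUl ?subsetUr.
have sAX : A \subset X.
  by apply: subset_trans sAn _; apply/subsetP=> i; rewrite inE => /andP[].
have [B [sB PB cB aB restB]] : exists B : {set I},
  [/\ B \subset X :\: A, shortage :\: A \subset B, #|B| <= u2,
    {in B, forall i, #|B| <= a2 i} &
    {in (X :\: A) :\: B, forall i, minn (a2 i) u2 <= #|B|}].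
  apply: greedy_class.
    apply/subsetP=> i /setDP[iP iA]; have := subsetP sP2 _ iP.
    by rewrite !inE iA => /andP[-> ->].
  have : #|shortage :\: A| <= #|shortage :\: P1| by apply/subset_leq_card/setDS.
  by rewrite (cardsDS sP1P) cP1; clear; lia.
have cXAB : #|(X :\: A) :\: B| = #|X| - u1 - #|B|.
  by rewrite (cardsDS sB) (cardsDS sAX) cA.
have key : {in (X :\: A) :\: B, forall i,
    #|X| - u1 - #|B| <= minn (a3 i) u3 + minn (a4 i) u4}.
  move=> i iXAB; have := restB i iXAB; move: iXAB; rewrite !inE.
  case/and3P=> iB iA iX hmin.
  have iS : i \notin shortage.
    by apply: contra iB => iP; apply: (subsetP PB); rewrite inE iA.
  have [hB|hB] := eqVneq #|B| u2.
    move: iS (hs i iX) (ha i iX); rewrite inE iX hB -ltnNge /=.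
    by clear=> h hsum [h1 h2 h3 h4]; lia.
  have {}hB : #|B| < u2 by rewrite ltn_neqAle hB.
  have i2 : a2 i <= #|B| by move: hmin hB; clear; lia.
  have i1 : a1 i < u1.
    case: alt => [sA|sA].
      rewrite ltnNge; apply: contra iA => h; apply: (subsetP sA).
      by rewrite !inE iX h /= andbT -ltnNge; move: i2 hB; clear; lia.
    (* Since [#|B| < u2], the greedy choice cannot leave out a row of [near2]. Hence
       [#|B| >= #|near2| - #|P1| >= u2], a contradiction. *)
    have : near2 :\: A \subset B.
      apply/subsetP=> k /setDP[]; rewrite inE => /andP[kX k2] kA.
      apply/negP=> /negP kB; have /restB : k \in (X :\: A) :\: B by rewrite !inE kB kA.
      by move: hB k2; clear; lia.
    move=> /subset_leq_card; rewrite cardsD setIC.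
    have := subset_leq_card sA; have := subset_leq_card sP2; rewrite cP1.
    by move: hB hn2; clear; lia.
  (* Cutting at [u3] and [u4] loses at most 2 from the row sum [#|X| + 1], and the strict bound
     [a1 i < u1] makes up for the deficit of 1. *)
  by move: (hs i iX) (ha i iX) i1 i2 hB; clear=> hsum [h1 h2 h3 h4]; lia.
have [C [sC _ cC aC restC]] : exists C : {set I},
  [/\ C \subset (X :\: A) :\: B, set0 \subset C, #|C| <= u3,
    {in C, forall i, #|C| <= a3 i} &
    {in (X :\: A :\: B) :\: C, forall i, minn (a3 i) u3 <= #|C|}].
  by apply: greedy_class; rewrite ?sub0set ?cards0.
pose D := (X :\: A :\: B) :\: C.
have cD : #|D| = #|X| - u1 - #|B| - #|C| by rewrite /D (cardsDS sC) cXAB.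
have hD i : i \in D -> #|D| <= minn (a4 i) u4.
  move=> iD; have := restC i iD; have /key : i \in X :\: A :\: B by case/setDP: iD.
  by rewrite cD; clear; lia.
have sD : D \subset X.
  by rewrite /D; do 2![apply: subset_trans (subsetDl _ _) _]; apply: subsetDl.
exists A, B, C, D; split.
- apply/subsetP=> i iX; rewrite !inE iX.
  by case: (i \in A); case: (i \in B); case: (i \in C).
- by split=> //; apply: subset_trans sB (subsetDl _ _).
- split=> //; apply: subset_trans sC _.
  by apply: subset_trans (subsetDl _ _) (subsetDl _ _).
- split=> //; first by rewrite cA.
  have [->|[i iD]] := set_0Vmem D; first by rewrite cards0.
  by move: (hD i iD); rewrite leq_min => /andP[].
- split=> //.
  + by move=> i /(subsetP sAn); rewrite inE cA => /andP[].
  + by move=> i /hD; rewrite leq_min => /andP[].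
Qed.

End Assignment.

Lemma sum_excess (I : finType) (X : {set I}) (a : I -> nat) (u : nat) :
  {in X, forall i, a i <= u.+1} ->
  \sum_(i in X) (a i - u) = #|[set i in X | u < a i]|.
Proof.
move=> ha; rewrite -sum1dep_card big_mkcondr; apply: eq_bigr => i iX.
by have := ha i iX; case: ltnP; lia.
Qed.

Lemma assignment (I : finType) (X : {set I}) (u1 u2 u3 u4 : nat)
  (a1 a2 a3 a4 : I -> nat) :
  {in X, forall i, [/\ a1 i <= u1.+1, a2 i <= u2.+1, a3 i <= u3.+1 & a4 i <= u4.+1]} ->
  {in X, forall i, a1 i + a2 i + a3 i + a4 i = #|X|.+1} ->
  [/\ u1 <= #|[set i in X | u1 <= a1 i]|, u2 <= #|[set i in X | u2 <= a2 i]|,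
      u3 <= #|[set i in X | u3 <= a3 i]| & u4 <= #|[set i in X | u4 <= a4 i]|] ->
  [/\ #|[set i in X | u1 < a1 i]| <= u1.*2, #|[set i in X | u2 < a2 i]| <= u2.*2,
      #|[set i in X | u3 < a3 i]| <= u3.*2 & #|[set i in X | u4 < a4 i]| <= u4.*2] ->
  assignable X u1 u2 u3 u4 a1 a2 a3 a4.
Proof.
move=> ha hs [n1 n2 n3 n4] [f1 f2 f3 f4].
have hN : #|X| <= u1 + u2 + u3 + u4.
  rewrite leqNgt; apply/negP=> hlt.
  (* Otherwise each row sum exceeds [u1 + u2 + u3 + u4] by at least 2, while the column bounds allow
     a total excess of at most twice that sum. *)
  have : \sum_(i in X) 2 <= \sum_(i in X) ((a1 i - u1) + (a2 i - u2) + (a3 i - u3) + (a4 i - u4)).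
    by apply: leq_sum => i iX; have [] := ha i iX; have := hs i iX; lia.
  rewrite sum_nat_const !big_split /= !sum_excess; try by move=> i /ha[].
  by move: hlt f1 f2 f3 f4; clear; lia.
(* For a row in both, let E and D be its total excess and deficit. Then [2E >= 4 + D] and, by [hN],
   [D >= E - 1], so [E >= 3] and only one column is deficient. The pair containing that column gives
   [E >= 2 + D], a contradiction. *)
have dis : #|shortage X u1 u2 u3 u4 a1 a2 a3 a4| + #|shortage X u3 u4 u1 u2 a3 a4 a1 a2| <= #|X|.
  rewrite -cardsUI [X in _ + #|pred_of_set X|](_ : _ = set0) ?cards0 ?addn0.
    by apply/subset_leq_card/subsetP=> i; rewrite !inE => /orP[] /andP[].
  apply/setP=> i; rewrite !inE; apply/negbTE/negP=> /andP[/andP[iX h1] /andP[_]].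
  by move: h1; have [] := ha i iX; have := hs i iX; lia.
have [h|h] := leqP #|shortage X u1 u2 u3 u4 a1 a2 a3 a4| (u1 + u2).
  exact: (half_assignment ha hs hN n1 n2 h).
have [|||||| Y3 [Y4 [Y1 [Y2 [sX [s3 s4] [s1 s2] [c3 c4 c1 c2] [b3 b4 b1 b2]]]]]] :=
  @half_assignment _ X u3 u4 u1 u2 a3 a4 a1 a2.
- by move=> i /ha[].
- by move=> i /hs; lia.
- by lia.
- by [].
- by [].
- by lia.
exists Y1, Y2, Y3, Y4; split=> //.
apply: subset_trans sX _; apply/subsetP=> i; rewrite !inE.
by case: (i \in Y1); case: (i \in Y2); case: (i \in Y3); case: (i \in Y4).
Qed.

(** * Rainbow sets on unions of components *)

(** Cuts sets down to a common exact size, as [forces_rainbow] and the induction on components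
    require. *)
Definition trunc (T : finType) (k : nat) (A : {set T}) : {set T} :=
  [set x in take k (enum A)].

Lemma trunc_sub (T : finType) (k : nat) (A : {set T}) : trunc k A \subset A.
Proof. by apply/subsetP=> x; rewrite inE => /mem_take; rewrite mem_enum. Qed.

Lemma card_trunc (T : finType) (k : nat) (A : {set T}) :
  k <= #|A| -> #|trunc k A| = k.
Proof.
move=> kA; rewrite cardsE (card_uniqP _) ?take_uniq ?enum_uniq //.
by rewrite size_take -cardE; case: ltngtP kA => // ->.
Qed.

Section Rainbow.
Variables (T : finType) (e : rel T) (I : finType).
Implicit Types (F : I -> {set T}) (X Y : {set I}) (K L : {set T}).

(* Outside Y the representative g i is arbitrary. *)
Definition rainbow_on F Y K : Prop :=
  exists g : I -> T,
  [/\ {in Y, forall i, g i \in F i :&: K}, {in Y &, injective g} &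
      {in Y &, forall i j, ~~ e (g i) (g j)}].

Definition removable F X K : Prop :=
  exists2 Y : {set I}, Y \subset X & rainbow_on F Y K /\
    {in X :\: Y, forall i, #|F i :&: K| <= #|Y|}.

Lemma rainbow_on_mono F F' X Y K L :
  X \subset Y -> {in X, forall i, F i :&: K \subset F' i :&: L} ->
  rainbow_on F Y K -> rainbow_on F' X L.
Proof.
move=> /subsetP sXY sF [g [g1 g2 g3]]; exists g; split.
- by move=> i iX; apply: (subsetP (sF i iX)); apply/g1/sXY.
- by move=> i j /sXY iY /sXY jY; apply: g2.
- by move=> i j /sXY iY /sXY jY; apply: g3.
Qed.

Lemma rainbow_on0 (t0 : T) F K : rainbow_on F set0 K.
Proof. by exists (fun=> t0); split=> i; rewrite inE. Qed.

Definition closed_set K : Prop := forall x y, e x y -> (x \in K) = (y \in K).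

(** No edge leaves a closed set, so representatives in [K] and [L] are distinct and nonadjacent. An
    index in both [Y] and [Z] keeps its representative in [K]. *)
Lemma rainbow_onU F Y Z K L :
  closed_set K -> closed_set L -> [disjoint K & L] ->
  rainbow_on F Y K -> rainbow_on F Z L -> rainbow_on F (Y :|: Z) (K :|: L).
Proof.
move=> clK clL /pred0P dKL [g [g1 g2 g3]] [h [h1 h2 h3]].
have dis x : x \in K -> x \in L -> False by move=> xK xL; have := dKL x; rewrite /= xK xL.
exists (fun i => if i \in Y then g i else h i); split.
- move=> i; case: ifPn => iY; rewrite !inE.
    by have /setIP[-> ->] := g1 i iY.
  by rewrite (negbTE iY) => /h1/setIP[-> ->]; rewrite orbT.
- move=> i j; rewrite !inE; case: ifPn => iY /=; case: ifPn => jY //= iZ jZ; [exact: g2| | |exact: h2].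
    by move=> E; case: (dis (h j)); [rewrite -E|]; [have /setIP[] := g1 i iY|have /setIP[] := h1 j jZ].
  by move=> E; case: (dis (h i)); [rewrite E|]; [have /setIP[] := g1 j jY|have /setIP[] := h1 i iZ].
- move=> i j; rewrite !inE; case: ifPn => iY /=; case: ifPn => jY //= iZ jZ; [exact: g3| | |exact: h3].
    apply/negP=> E; apply: (dis (h j)); last by have /setIP[] := h1 j jZ.
    by rewrite -(clK _ _ E); have /setIP[] := g1 i iY.
  apply/negP=> E; apply: (dis (g j)); first by have /setIP[] := g1 j jY.
  by rewrite -(clL _ _ E); have /setIP[] := h1 i iZ.
Qed.

Lemma closed_setU K L : closed_set K -> closed_set L -> closed_set (K :|: L).
Proof. by move=> cK cL x y xy; rewrite !inE (cK _ _ xy) (cL _ _ xy). Qed.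

Lemma closed_set0 : closed_set set0.
Proof. by move=> x y _; rewrite !inE. Qed.

(** For a simple graph this says that [K] induces a forest. *)
Definition degenerate K : Prop := forall W : {set T}, W != set0 -> W \subset K ->
  exists2 v, v \in W & #|[set y in W | e v y]| <= 1.

Lemma independent_sub (A B : {set T}) :
  A \subset B -> independent e B -> independent e A.
Proof. by move=> /subsetP sAB iB x y /sAB xB /sAB yB; apply: iB. Qed.

(* Greedy: pick a vertex of degree at most one in the union of the sets; each
   other independent set loses at most one vertex with its closed neighbourhood. *)
Lemma degenerate_rainbow (t0 : T) F Y K :
  symmetric e -> irreflexive e -> degenerate K ->
  {in Y, forall i, independent e (F i) /\ #|Y| <= #|F i :&: K|} ->
  rainbow_on F Y K.
Proof.
move=> esym eirr degK; move: {2}#|Y| (erefl #|Y|) => k.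
elim: k F Y => [|k IHk] F Y cY hF.
  by move/eqP: cY; rewrite cards_eq0 => /eqP->; apply: rainbow_on0.
pose W := \bigcup_(i in Y) (F i :&: K).
have FW i : i \in Y -> F i :&: K \subset W by move=> iY; rewrite /W (bigcup_max i).
have W0 : W != set0.
  have /card_gt0P[i iY] : 0 < #|Y| by rewrite cY.
  have [_] := hF i iY; rewrite cY => h; have /card_gt0P[x xF] := leq_ltn_trans (leq0n k) h.
  by apply/set0Pn; exists x; apply: (subsetP (FW i iY)).
have [|v vW dv] := degK W W0; first by apply/bigcupsP=> i _; apply: subsetIr.
have /bigcupP[i0 i0Y vF] := vW.
pose F' i := [set x in F i | (x != v) && ~~ e v x].
have [||g [g1 g2 g3]] := IHk F' (Y :\ i0).
- by have := cardsD1 i0 Y; rewrite i0Y cY add1n => -[].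
- move=> i /setD1P[_ iY]; have [indF cF] := hF i iY; split.
    by apply: independent_sub indF; apply/subsetP=> x; rewrite inE => /andP[].
  have := cardsD1 i0 Y; rewrite i0Y add1n => E; rewrite E in cF.
  rewrite -ltnS; apply: leq_trans cF _.
  have -> : F' i :&: K = (F i :&: K) :\: [set x in F i :&: K | (x == v) || e v x].
    by apply/setP=> x; rewrite !inE; case: (x \in F i); case: (x \in K); rewrite //= ?andbF ?andbT //= negb_or.
  set B := [set x in _ | _].
  rewrite -(cardsID B (F i :&: K)) addnC -addn1 leq_add2l.
  rewrite (_ : _ :&: B = B); last by apply/setIidPr/subsetP=> x; rewrite inE => /andP[].
  (* If [v] is in [F i], independence keeps its neighbours out and only [v] is lost; otherwise only
     neighbours of [v] in [W] are lost, at most one. *)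
  have [vFi|vFi] := boolP (v \in F i).
    rewrite -(cards1 v); apply: subset_leq_card; apply/subsetP=> x.
    rewrite !inE => /andP[/andP[xF _] /orP[//|vx]].
    by case/negP: (indF _ _ vFi xF).
  apply: leq_trans dv; apply: subset_leq_card; apply/subsetP=> x.
  rewrite [x \in B]inE => /andP[xFK]; rewrite inE (subsetP (FW i iY) _ xFK) /=.
  by case/orP=> // /eqP xv; move: xFK vFi; rewrite xv inE => /andP[->].
exists (fun i => if i == i0 then v else g i).
have gv i : i \in Y -> i != i0 -> (g i != v) && ~~ e v (g i).
  move=> iY ii0; have := g1 i; rewrite !inE ii0 iY => /(_ isT).
  by case/andP=> /andP[_].
split.
- move=> i iY; case: eqP => [->//|/eqP ii0].
  by have := g1 i; rewrite !inE ii0 iY => /(_ isT) /andP[/andP[-> _] ->].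
- move=> i j iY jY; case: eqP => [->|/eqP ii0]; case: eqP => [->//|/eqP jj0].
  + by have /andP[/eqP h _] := gv j jY jj0 => E; case: h.
  + by have /andP[/eqP h _] := gv i iY ii0 => E; case: h.
  + by apply: g2; rewrite !inE ?ii0 ?jj0.
- move=> i j iY jY; case: eqP => [_|/eqP ii0]; case: eqP => [_|/eqP jj0].
  + by rewrite eirr.
  + by have /andP[] := gv j jY jj0.
  + by rewrite esym; have /andP[] := gv i iY ii0.
  + by apply: g3; rewrite !inE ?ii0 ?jj0.
Qed.

Lemma constant_rainbow (t0 : T) F Y K (S : {set T}) :
  independent e S -> #|Y| <= #|S| -> {in Y, forall i, F i :&: K = S} ->
  rainbow_on F Y K.
Proof.
move=> indS cY hF.
pose g i := nth t0 (enum S) (index i (enum Y)).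
have idx i : i \in Y -> index i (enum Y) < size (enum S).
  by move=> iY; rewrite -cardE; apply: leq_trans cY; rewrite cardE index_mem mem_enum.
have gS i : i \in Y -> g i \in S by move=> /idx h; rewrite -mem_enum mem_nth.
exists g; split.
- by move=> i iY; rewrite hF // gS.
- move=> i j iY jY /eqP; rewrite nth_uniq ?enum_uniq ?idx // => /eqP E.
  by rewrite -(nth_index i (s:=enum Y) (x:=i)) ?mem_enum // E nth_index ?mem_enum.
- by move=> i j iY jY; apply: indS; apply: gS.
Qed.

(** A rainbow set of [#|Y|] vertices from [#|Y|] sets uses every index, hence gives a representative
    for each set. *)
Lemma cycle_rainbow (t0 : T) F Y K (l : nat) (f : 'I_l -> T) :
  forces_rainbow (@cycle_graph l) #|Y| #|Y| #|Y| ->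
  injective f -> f @: setT = K -> (forall i j, e (f i) (f j) = cycle_graph i j) ->
  {in Y, forall i, independent e (F i) /\ #|Y| <= #|F i :&: K|} ->
  rainbow_on F Y K.
Proof.
move=> force finj fK fe hF.
pose G (k : 'I_#|Y|) := trunc #|Y| (f @^-1: F (enum_val k)).
have sG k : {subset G k <= f @^-1: F (enum_val k)} by apply/subsetP/trunc_sub.
have hG k : independent (@cycle_graph l) (G k) /\ #|G k| = #|Y|.
  have [indF cF] := hF _ (enum_valP k); split.
    move=> x y /sG + /sG; rewrite !inE => xF yF; rewrite -fe; exact: indF.
  apply: card_trunc; apply: leq_trans cF _; rewrite -fK.
  rewrite -(card_imset _ finj); apply/subset_leq_card/subsetP=> x /setIP[xF /imsetP[z _ E]].
  by apply/imsetP; exists z; rewrite // inE -E.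
have [R [[m [i [x [imono xinj xG defR]]]] indR cR]] := force G hG.
have cm : m = #|Y| by rewrite -cR defR card_imset // card_ord.
have iinj : injective i.
  move=> a b E; apply/val_inj/eqP; case: (ltngtP (val a) (val b)) => // h;
  by have := imono _ _ h; rewrite E ltnn.
have isurj k : k \in codom i by apply: inj_card_onto; rewrite // !card_ord cm.
(* As [i] is onto, the default [t0] does not occur on [Y]. *)
pose g r := if [pick a | enum_val (i a) == r] is Some a then f (x a) else t0.
have gP r : r \in Y -> exists2 a, enum_val (i a) = r & g r = f (x a).
  move=> rY; rewrite /g; case: pickP => [a /eqP Ea|no]; first by exists a.
  have /codomP[a Ea] := isurj (enum_rank_in rY r).
  by have := no a; rewrite -Ea enum_rankK_in // eqxx.
have xR a : x a \in R by rewrite defR imset_f.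
exists g; split.
- move=> r /gP[a Ea ->]; rewrite inE -fK imset_f // andbT.
  by have := sG _ _ (xG a); rewrite inE Ea.
- by move=> r r' /gP[a <- ->] /gP[b <- ->] /finj/xinj ->.
- by move=> r r' /gP[a _ ->] /gP[b _ ->]; rewrite fe; apply: indR.
Qed.
End Rainbow.

(** * Components of graphs of maximum degree two *)

Section Components.
Variables (T : finType) (e : rel T).
Hypotheses (e_sym : symmetric e) (e_irr : irreflexive e).
Hypothesis hdeg : forall x, #|[set y | e x y]| <= 2.

Lemma component_eq K x : K \in components e -> x \in K ->
  K = [set y | connect e x y].
Proof.
case/imsetP=> z _ -> ; rewrite !inE /= => zx.
apply/setP=> y; rewrite !inE /=.
by rewrite (same_connect (sym_connect_sym e_sym) zx).
Qed.

Lemma component_closed K : K \in components e -> closed_set e K.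
Proof.
move=> Kc; have cl x y : e x y -> x \in K -> y \in K.
  by move=> xy xK; rewrite (component_eq Kc xK) inE connect1.
by move=> x y xy; apply/idP/idP; apply: cl; rewrite // e_sym.
Qed.

Lemma component_neq0 K : K \in components e -> exists x, x \in K.
Proof. by case/imsetP=> z _ ->; exists z; rewrite !inE connect0. Qed.

Lemma component_min K (W : {set T}) : K \in components e -> W \subset K ->
  W != set0 -> {in W, forall x y, e x y -> y \in W} -> W = K.
Proof.
move=> Kc sWK /set0Pn[x xW] cl; apply/eqP; rewrite eqEsubset sWK.
apply/subsetP=> y; rewrite (component_eq Kc (subsetP sWK _ xW)) inE => xy.
rewrite -(@closed_connect _ e (mem W) _ x y) //.
by move=> a b ab; apply/idP/idP => h; apply: cl h _ _; rewrite // e_sym.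
Qed.

Lemma components_partition : partition (components e) setT.
Proof.
apply: equivalence_partitionP => x y z _ _ _; split; first exact: connect0.
by move=> xy; rewrite (same_connect (sym_connect_sym e_sym) xy).
Qed.

(** Continues a step from [x] to [y] without turning back. The default [y] is excluded when [y] has
    degree at least two. *)
Definition next_vertex x y := odflt y [pick z | e y z & z != x].

Definition walk (x y : T) (k : nat) : T :=
  (iter k (fun p => (p.2, next_vertex p.1 p.2)) (x, y)).1.

Lemma walkSS x y k : walk x y k.+2 = next_vertex (walk x y k) (walk x y k.+1).
Proof. by []. Qed.

(* A walk that never backtracks in a 2-regular graph first returns at its
   starting point. *)
Lemma regular_component_cycle K : K \in components e ->
  {in K, forall x, 2 <= #|[set y | e x y]|} ->
  3 <= #|K| /\ induced_iso e K (@cycle_graph #|K|).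
Proof.
move=> Kc deg2; have [x0 x0K] := component_neq0 Kc.
have clK := component_closed Kc.
have /card_gt0P[x1] : 0 < #|[set y | e x0 y]| by apply: leq_trans (deg2 _ x0K).
rewrite inE => e01; pose v := walk x0 x1.
have nextP x y : y \in K -> e y (next_vertex x y) && (next_vertex x y != x).
  move=> yK; rewrite /next_vertex; case: pickP => //= no.
  have : [set z | e y z] \subset [set x].
    by apply/subsetP=> z; rewrite !inE => yz; have := no z; rewrite yz => /negbFE.
  by move/subset_leq_card; rewrite cards1 => /(leq_trans (deg2 _ yK)).
have vP k : v k \in K /\ e (v k) (v k.+1).
  elim: k => [|k [kK ek]]; first by [].
  have k1K : v k.+1 \in K by rewrite -(clK _ _ ek).
  by split=> //; rewrite /v walkSS; have /andP[] := nextP (v k) _ k1K.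
have vK k : v k \in K by case: (vP k).
have vE k : e (v k) (v k.+1) by case: (vP k).
have vN k : v k.+2 != v k by rewrite /v walkSS; have /andP[] := nextP (v k) _ (vK k.+1).
have nbr2 x y z : e x y -> e x z -> y != z -> forall w, e x w -> w = y \/ w = z.
  move=> xy xz yz w xw.
  have : w \in [set u | e x u] by rewrite inE.
  suff <- : [set y; z] = [set u | e x u].
    by rewrite !inE => /orP[] /eqP; [left|right].
  apply/eqP; rewrite eqEcard cards2 yz hdeg andbT.
  by apply/subsetP=> u; rewrite !inE => /orP[] /eqP->.
have nbr k w : e (v k.+1) w -> w = v k \/ w = v k.+2.
  by apply: nbr2; rewrite // 1?e_sym // eq_sym.
pose P l := [exists i : 'I_l, v i == v l].
have exP : exists l, P l.
  suff : ~~ injectiveb (fun i : 'I_#|T|.+1 => v i).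
    case/injectivePn=> i [j ij E].
    case: (ltngtP i j) => h; last by case/eqP: ij; apply: val_inj.
      by exists (val j); apply/existsP; exists (Ordinal h); rewrite E.
    by exists (val i); apply/existsP; exists (Ordinal h); rewrite E.
  apply/negP=> /injectiveP/leq_card; rewrite card_ord; lia.
case: (ex_minnP exP) => l /existsP[i /eqP vil] lmin.
have vinj a b : a < b -> b < l -> v a <> v b.
  move=> ab bl E; suff : l <= b by lia.
  by apply: lmin; apply/existsP; exists (Ordinal ab); rewrite /= E.
(* If the first repetition were at [v i.+1], the vertex before [v l] would be one of its two
   neighbours [v i] and [v i.+2]. This gives an earlier repetition, a loop or a backtracking
   step. *)
have {vil}vl0 : v 0 = v l.
  case: i vil => -[|i] il //= vil.
  have [l' El] : exists l', l = l'.+1 by case: (l) il => // l' _; exists l'.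
  have : e (v i.+1) (v l') by rewrite vil El e_sym.
  case/nbr => E.
    by case: (@vinj i l'); rewrite ?El //; lia.
  case: (ltngtP i.+2 l') => h.
  - by case: (@vinj i.+2 l') => //; lia.
  - have E2 : l' = i.+1 by lia.
    by have := vE l'; rewrite -El -vil -E2 e_irr.
  - by have := vN i.+1; rewrite h -El vil eqxx.
have l3 : 2 < l.
  case: l vl0 {lmin vinj} i => [|[|[|l]]] // vl0 [] //.
    by have := vE 0; rewrite -vl0 e_irr.
  by have := vN 0; rewrite -vl0 eqxx.
have [l' El] : exists l', l = l'.+1 by case: (l) l3 => // l' _; exists l'.
have nbr0 w : e (v 0) w -> w = v 1 \/ w = v l'.
  apply: nbr2; first exact: vE.
    by rewrite vl0 El e_sym.
  by apply/eqP=> E; case: (@vinj 1 l') => //; lia.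
pose f := [ffun i : 'I_l => v i].
have finj : injective f.
  move=> a b; rewrite !ffunE => E; apply: val_inj.
  by case: (ltngtP a b) => // h; [case: (vinj _ _ h)|case: (vinj _ _ h)].
have vmod k : k <= l -> v k = v (k %% l).
  by rewrite leq_eqVlt => /orP[/eqP->|kl]; rewrite ?modnn ?modn_small.
have edge (j1 j2 : 'I_l) : e (v j1) (v j2) = cycle_graph j1 j2.
  apply/idP/orP => [|[] /eqP/= E]; last first.
  - by rewrite E -vmod // e_sym vE.
  - by rewrite E -vmod.
  case: j1 j2 => [[|i1] il] [j jl] /=.
    case/nbr0 => E; [left|right].
      by rewrite modn_small; last lia; apply/eqP; case: (ltngtP j 1) => // h; case: (vinj _ _ h); rewrite ?E //; lia.
    have -> : j = l' by case: (ltngtP j l') => // h; case: (vinj _ _ h); rewrite ?E //; lia.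
    by rewrite -El modnn.
  case/nbr => E; [right|left].
    have -> : j = i1 by case: (ltngtP j i1) => // h; case: (vinj _ _ h); rewrite ?E //; lia.
    by rewrite modn_small.
  have [il2|il2] := ltnP i1.+2 l.
    by rewrite modn_small //; apply/eqP; case: (ltngtP j i1.+2) => // h; case: (vinj _ _ h); rewrite ?E //; lia.
  have E2 : i1.+2 = l by lia.
  rewrite E2 modnn; apply/eqP; case: (ltngtP j 0) => // h; case: (vinj _ _ h); rewrite // E E2 //.
(* The visited vertices are closed under adjacency, hence fill the component. *)
have fK : f @: setT = K.
  apply: component_min => //.
  - by apply/subsetP=> _ /imsetP[i' _ ->]; rewrite ffunE.
  - by apply/set0Pn; exists (f i); apply: imset_f.
  - move=> _ /imsetP[k _ ->] y; rewrite ffunE => ky.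
    suff [m ml ->] : exists2 m, m <= l & y = v m.
      rewrite vmod //; have h : m %% l < l by rewrite ltn_pmod; lia.
      by apply/imsetP; exists (Ordinal h); rewrite ?ffunE.
    case: k ky => -[|k] kl /=.
      by case/nbr0=> ->; [exists 1|exists l'] => //; lia.
    by case/nbr=> ->; [exists k|exists k.+2] => //; lia.
have cK : l = #|K| by rewrite -fK card_imset // cardsT card_ord.
rewrite -cK; split=> //; apply/existsP; exists f; apply/and3P; split.
- exact/injectiveP.
- exact/eqP.
- by apply/forallP=> a; apply/forallP=> b; rewrite !ffunE edge.
Qed.

(** A subset [W] violating degeneracy has all degrees within [W] at least two, so by [hdeg] it
    contains all neighbours of its vertices and equals [K], which is thus 2-regular. *)
Lemma component_dichotomy K : K \in components e ->
  degenerate e K \/ 3 <= #|K| /\ induced_iso e K (@cycle_graph #|K|).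
Proof.
move=> Kc.
have [/existsP[W /and3P[W0 sWK /forall_inP dW]]|no] := boolP [exists W : {set T},
  [&& W != set0, W \subset K & [forall v in W, 2 <= #|[set y in W | e v y]|]]].
  right; apply: regular_component_cycle => //.
  have sub v : [set y in W | e v y] \subset [set y | e v y].
    by apply/subsetP=> y; rewrite !inE => /andP[].
  suff WK : W = K by move=> v; rewrite -WK => /dW h; apply: leq_trans h (subset_leq_card (sub v)).
  apply: component_min => // x xW y xy.
  have /eqP E : [set y in W | e x y] == [set y | e x y].
    by rewrite eqEcard sub; apply: leq_trans (hdeg x) (dW _ xW).
  have : y \in [set y | e x y] by rewrite inE.
  by rewrite -E inE => /andP[].
left=> W W0 sWK; move: no; rewrite negb_exists => /forallP/(_ W).
rewrite W0 sWK /= negb_forall_in => /exists_inP[v vW h].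
by exists v => //; rewrite -ltnS ltnNge.
Qed.

End Components.

(** * Even cycles and the induction on components *)

Lemma sum_periodic (c : nat -> nat) (l r : nat) : (forall k, c (k + l) = c k) ->
  \sum_(k < l) c (r + k) = \sum_(k < l) c k.
Proof.
move=> per; elim: r => // r <-; case: l per => [|l] per; first by rewrite !big_ord0.
rewrite big_ord_recr big_ord_recl /= addn0 addnC; congr (_ + _).
  by rewrite addSnnS per.
by apply: eq_bigr => k _; rewrite /bump leq0n add1n addSnnS.
Qed.

Section Cycles.
Variables (T : finType) (e : rel T) (K : {set T}).
Hypothesis K3 : 3 <= #|K|.
Hypothesis isoK : induced_iso e K (@cycle_graph #|K|).

(** Unrolls the cycle into a periodic sequence, so that adjacency becomes succession. *)
Lemma cycle_walk : exists v : nat -> T,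
  [/\ forall k, v (k + #|K|) = v k, forall k, e (v k) (v k.+1),
      forall x, x \in K -> exists k, x = v k &
      forall A : {set T}, #|A :&: K| = \sum_(k < #|K|) (v k \in A)].
Proof.
have /existsP[f /and3P[/injectiveP finj /eqP fK /forallP fe]] := isoK.
have fin z : f z \in K by have := imset_f f (in_setT z); rewrite fK.
have fS x : x \in K -> exists z, x = f z.
  move=> xK; have : x \in f @: setT by rewrite fK.
  by case/imsetP=> z _ ->; exists z.
have l0 : 0 < #|K| by lia.
pose o k : 'I_#|K| := Ordinal (ltn_pmod k l0).
exists (fun k => f (o k)); split.
- by move=> k; congr (f _); apply: val_inj; rewrite /= modnDr.
- move=> k; have /forallP/(_ (o k.+1))/eqP -> := fe (o k).
  by apply/orP; left; rewrite /= -[k.+1]addn1 -[(_ %% _).+1]addn1 modnDml.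
- move=> x /fS[i ->]; exists i; congr (f _).
  by apply: val_inj; rewrite /= modn_small.
- move=> A; have -> : A :&: K = f @: (f @^-1: A).
    apply/setP=> x; rewrite inE; apply/andP/imsetP => [[xA]|[z zA ->]].
      by move=> /fS[z E]; exists z; rewrite // inE -E.
    by rewrite inE in zA.
  rewrite card_imset // -sum1dep_card big_mkcond /=; apply: eq_bigr => k _.
  have -> : o k = k by apply: val_inj; rewrite /= modn_small.
  by case: (f k \in A).
Qed.

(** Each pair of consecutive vertices contains at most one vertex of [A]; summing over the cycle
    counts each vertex twice. Equality forces membership to alternate, so one vertex determines the
    trace. *)
Lemma independent_cycle_trace :
  (forall A : {set T}, independent e A -> #|A :&: K|.*2 <= #|K|) /\
  exists v0 : T, forall A B : {set T}, independent e A -> independent e B ->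
    #|A :&: K|.*2 = #|K| -> #|B :&: K|.*2 = #|K| ->
    (v0 \in A) = (v0 \in B) -> A :&: K = B :&: K.
Proof.
have [v [vper ve vK vsum]] := cycle_walk.
pose c (A : {set T}) k : nat := v k \in A.
have cper A k : c A (k + #|K|) = c A k by rewrite /c vper.
have c1 A : independent e A -> forall k, c A k + c A k.+1 <= 1.
  move=> indA k; rewrite /c.
  case kA : (v k \in A); case k1A : (v k.+1 \in A) => //.
  by have := indA _ _ kA k1A; rewrite ve.
have csum (A : {set T}) : \sum_(k < #|K|) (c A k + c A k.+1) = #|A :&: K|.*2.
  by rewrite big_split /= (sum_periodic 1 (cper A)) -addnn vsum.
split=> [A /c1 cA|].
  rewrite -csum; apply: (@leq_trans (\sum_(k < #|K|) 1)); first exact: leq_sum.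
  by rewrite sum1_card card_ord.
have alternate A : independent e A -> #|A :&: K|.*2 = #|K| -> forall k, c A k + c A k.+1 = 1.
  move=> /c1 cA; rewrite -csum => sA k.
  have : \sum_(i < #|K|) (1 - (c A i + c A i.+1)) == 0.
    rewrite sumnB; last by move=> i _; apply: cA.
    by rewrite sA sum1_card card_ord subnn.
  have l0 : 0 < #|K| by lia.
  rewrite sum_nat_eq0 => /forallP/(_ (Ordinal (ltn_pmod k l0))) /=.
  have -> : c A (k %% #|K|).+1 = c A k.+1.
    by rewrite [in RHS](divn_eq k #|K|) -addnS addnC; elim: (_ %/ _) => [|q IHq]; rewrite ?addn0 // mulSn addnCA addnC cper.
  have -> : c A (k %% #|K|) = c A k.
    by rewrite [in RHS](divn_eq k #|K|) addnC; elim: (_ %/ _) => [|q IHq]; rewrite ?addn0 // mulSn addnCA addnC cper.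
  by move: (cA k); lia.
exists (v 0) => A B indA indB sA sB v0.
have AB k : (v k \in A) = (v k \in B).
  elim: k => // k IHk.
  have := alternate A indA sA k; have := alternate B indB sB k.
  by rewrite /c IHk; case: (v k \in B); case: (v k.+1 \in A); case: (v k.+1 \in B).
apply/setP=> x; rewrite !inE; case: (boolP (x \in K)); rewrite ?andbF // => xK.
by have [k ->] := vK x xK; rewrite AB.
Qed.

End Cycles.

(** * Removable components and tight even cycles *)

Section Main.
Hypothesis hcycle : forall m l : nat, 0 < m -> 2 * m + 1 <= l ->
  f_is (@cycle_graph l) m m m.
Variables (T : finType) (e : rel T) (t0 : T).
Hypotheses (e_sym : symmetric e) (e_irr : irreflexive e).
Hypothesis hdeg : forall x, #|[set y | e x y]| <= 2.
Variable I : finType.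
Implicit Types (F : I -> {set T}) (X Y : {set I}) (K : {set T}).

Definition full_rows F X K : {set I} := [set i in X | #|K|./2 <= #|F i :&: K|].

Definition tight F X K : bool :=
  [&& is_even_cycle e K, #|K|./2 <= #|full_rows F X K| &
      #|full_rows F X K| <= (#|K|./2).-1.*2].

(* An independent set meeting an even cycle in half of its vertices has one of
   two traces there, so 2 s - 1 such sets include s with the same trace. *)
Lemma not_tight_removable F X K : {in X, forall i, independent e (F i)} ->
  K \in components e -> ~~ tight F X K -> removable e F X K.
Proof.
move=> indF Kc ntK.
(* No trace exceeds the cap [#|T|], so [#|Y|] is the largest k such that k sets meet [K] in at least
   k vertices. *)
have [||Y [sYX _ _ aY restY]] :=
  @greedy_class _ X set0 (fun i => #|F i :&: K|) #|T|; rewrite ?sub0set ?cards0 //.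
have {}restY : {in X :\: Y, forall i, #|F i :&: K| <= #|Y|}.
  by move=> i /restY; rewrite (minn_idPl _) // max_card.
have hY : {in Y, forall i, independent e (F i) /\ #|Y| <= #|F i :&: K|}.
  by move=> i iY; split; [apply/indF/(subsetP sYX)|apply: aY].
have [degK|[K3 isoK]] := component_dichotomy e_sym e_irr hdeg Kc.
  by exists Y => //; split=> //; apply: degenerate_rainbow hY.
have [/eqP|Y0] := posnP #|Y|.
  by rewrite cards_eq0 => /eqP Y0; exists Y => //; split=> //; rewrite Y0; apply: rainbow_on0.
have [small|big] := leqP (2 * #|Y| + 1) #|K|.
  exists Y => //; split=> //; have [force _] := hcycle Y0 small.
  have /existsP[f /and3P[/injectiveP finj /eqP fK /forallP fe]] := isoK.
  apply: (cycle_rainbow t0 force finj fK) => // i j.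
  by have /forallP/(_ j)/eqP := fe i.
have [half [v0 trace]] := independent_cycle_trace K3 isoK.
(* Here [#|K| <= 2 * #|Y|], while a set in [Y] has at least [#|Y|] and at most [#|K| / 2] vertices
   on [K]. Odd cycles are thereby excluded. *)
have cK : #|K| = #|Y|.*2.
  have /card_gt0P[i iY] := Y0; have [indFi cFi] := hY i iY.
  by have := half _ indFi; lia.
have evenK : is_even_cycle e K by rewrite /is_even_cycle K3 isoK cK odd_double.
have cK2 : #|K|./2 = #|Y| by rewrite cK doubleK.
have sYf : Y \subset full_rows F X K.
  by apply/subsetP=> i iY; rewrite inE (subsetP sYX) // cK2 aY.
move: ntK; rewrite /tight evenK cK2 (subset_leq_card sYf) /= -ltnNge => many.
have full i : i \in full_rows F X K -> independent e (F i) /\ #|F i :&: K|.*2 = #|K|.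
  rewrite inE cK2 => /andP[iX h]; have indFi := indF i iX; split=> //.
  by have := half _ indFi; lia.
have [b hb] : exists b : bool, #|Y| <= #|[set i in full_rows F X K | (v0 \in F i) == b]|.
  have := cardsID [set i | v0 \in F i] (full_rows F X K).
  rewrite [_ :&: _](_ : _ = [set i in full_rows F X K | (v0 \in F i) == true]); last first.
    by apply/setP=> i; rewrite !inE eqb_id.
  rewrite [_ :\: _](_ : _ = [set i in full_rows F X K | (v0 \in F i) == false]); last first.
    by apply/setP=> i; rewrite !inE eqbF_neg andbC.
  move=> sum; have [h|h] := leqP #|Y| #|[set i in full_rows F X K | (v0 \in F i) == true]|.
    by exists true.
  by exists false; move: sum h many Y0; set p := #|_|; set q := #|_|; clear; lia.
have c0Y : #|set0 : {set I}| <= #|Y| by rewrite cards0.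
have [Z [_ sZ cZ]] := subset_between (sub0set _) c0Y hb.
have sZX : Z \subset X.
  by apply/subsetP=> i /(subsetP sZ); rewrite !inE => /andP[/andP[]].
have Zfull i : i \in Z -> [/\ independent e (F i), #|F i :&: K|.*2 = #|K| & (v0 \in F i) = b].
  by move=> /(subsetP sZ); rewrite inE => /andP[/full[? ?] /eqP].
have /card_gt0P[i0 /Zfull[ind0 c0 b0]] : 0 < #|Z| by rewrite cZ.
exists Z => //; split.
  apply: (@constant_rainbow _ _ _ t0 _ _ _ (F i0 :&: K)).
  - exact: independent_sub (subsetIl _ _) ind0.
  - by rewrite cZ; move: c0 cK; clear; lia.
  - by move=> i /Zfull[indi ci bi]; apply: trace; rewrite ?ci ?c0 ?bi ?b0.
move=> i /setDP[iX _]; rewrite cZ; have := half _ (indF i iX).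
by rewrite cK leq_double.
Qed.

Lemma cover_setD1 (P : {set {set T}}) K : trivIset P -> K \in P ->
  cover P = K :|: cover (P :\ K) /\ [disjoint K & cover (P :\ K)].
Proof.
move=> /trivIsetP tP KP; split; first by rewrite /cover (big_setD1 K).
apply: bigcup_disjoint => L /setD1P[LK LP]; apply: tP => //.
by rewrite eq_sym.
Qed.

(* Missing parts are padded with the empty set. *)
Lemma cover_four (P : {set {set T}}) : trivIset P -> #|P| <= 4 ->
  exists K1 K2 K3 K4 : {set T},
  [/\ {in [:: K1; K2; K3; K4], forall K, K = set0 \/ K \in P},
      cover P = K1 :|: (K2 :|: (K3 :|: K4)),
      [disjoint K1 & K2 :|: (K3 :|: K4)], [disjoint K2 & K3 :|: K4] &
      [disjoint K3 & K4]].
Proof.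
have peel (Q : {set {set T}}) : trivIset Q -> exists K (Q' : {set {set T}}),
    [/\ K = set0 \/ K \in Q, Q' \subset Q, trivIset Q', #|Q'| = #|Q|.-1 &
      cover Q = K :|: cover Q' /\ [disjoint K & cover Q']].
  move=> tQ; have [->|[K KQ]] := set_0Vmem Q.
    exists set0, set0; split; rewrite ?cards0 //; first by left.
    - exact: trivIsetS (sub0set Q) tQ.
    - by split; rewrite ?set0U // -setI_eq0 set0I.
  exists K, (Q :\ K); split; first by right.
  - exact: subsetDl.
  - exact: trivIsetS (subsetDl _ _) tQ.
  - by rewrite [in RHS](cardsD1 K) KQ.
  - exact: cover_setD1.
move=> tP cP.
have [K1 [P1 [h1 s1 t1 c1 [-> d1]]]] := peel _ tP.
have [K2 [P2 [h2 s2 t2 c2 [e2 d2]]]] := peel _ t1.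
have [K3 [P3 [h3 s3 t3 c3 [e3 d3]]]] := peel _ t2.
have [K4 [P4 [h4 s4 t4 c4 [e4 d4]]]] := peel _ t3.
have /eqP : #|P4| = 0 by rewrite c4 c3 c2 c1; move: cP; clear; lia.
rewrite cards_eq0 => /eqP P40.
have {}e4 : cover P3 = K4 by rewrite e4 P40 /cover big_set0 setU0.
exists K1, K2, K3, K4; split.
- move=> K; rewrite !inE => /or4P[] /eqP->.
  + exact: h1.
  + by case: h2 => [|h]; [left|right; apply: (subsetP s1)].
  + by case: h3 => [|h]; [left|right; apply/(subsetP s1)/(subsetP s2)].
  + by case: h4 => [|h]; [left|right; apply/(subsetP s1)/(subsetP s2)/(subsetP s3)].
- by rewrite e2 e3 e4.
- by rewrite -e4 -e3 -e2.
- by rewrite -e4 -e3.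
- by rewrite -e4.
Qed.

Lemma closed_cover (P : {set {set T}}) :
  P \subset components e -> closed_set e (cover P).
Proof.
move=> /subsetP sP x y xy; rewrite /cover; apply/bigcupP/bigcupP => -[K KP h];
by exists K => //; move: h; rewrite (component_closed e_sym (sP K KP) xy).
Qed.

Lemma card_setIU (A B C : {set T}) : [disjoint B & C] ->
  #|A :&: (B :|: C)| = #|A :&: B| + #|A :&: C|.
Proof.
move=> /disjoint_setI0 d; rewrite setIUr cardsU setIACA d setI0 cards0.
by rewrite subn0.
Qed.

(** Supplies what [assignment] needs about one column. As [u] is one less than half the cycle
    length, classes of size at most [u] fall under the hypothesis on cycles. The padding [set0] is a
    column with [u = 0]. *)
Lemma tight_column F X K : {in X, forall i, independent e (F i)} ->
  K = set0 \/ K \in components e /\ tight F X K ->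
  let u := (#|K|./2).-1 in
  [/\ closed_set e K,
      {in X, forall i, #|F i :&: K| <= u.+1},
      u <= #|[set i in X | u <= #|F i :&: K|]|,
      #|[set i in X | u < #|F i :&: K|]| <= u.*2 &
      forall Y, Y \subset X -> #|Y| <= u ->
        {in Y, forall i, #|Y| <= #|F i :&: K|} -> rainbow_on e F Y K].
Proof.
move=> indF [->|[Kc /and3P[/and3P[K3 oddK isoK] many few]]] /=.
  rewrite cards0 /=; split=> //.
  - exact: closed_set0.
  - by move=> i _; rewrite setI0 cards0.
  - by rewrite leqn0 cards_eq0; apply/eqP/setP=> i; rewrite !inE setI0 cards0 andbF.
  - by move=> Y _; rewrite leqn0 cards_eq0 => /eqP-> _; apply: rainbow_on0.
have [half _] := independent_cycle_trace K3 isoK.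
have Eu : #|K|./2 = (#|K|./2).-1.+1 by lia.
have cK : #|K| = (#|K|./2).*2 by rewrite -[LHS]odd_double_half (negbTE oddK).
rewrite /full_rows in many few.
split.
- exact: component_closed.
- move=> i iX; have := half _ (indF i iX).
  by rewrite {1}cK leq_double -Eu.
- apply: leq_trans (leq_pred _) (leq_trans many _); apply/subset_leq_card/subsetP=> i.
  by rewrite !inE => /andP[-> h]; apply: leq_trans (leq_pred _) h.
- by rewrite -Eu.
- move=> Y sYX cY aY.
  have [/eqP|Y0] := posnP #|Y|.
    by rewrite cards_eq0 => /eqP->; apply: rainbow_on0.
  have small : 2 * #|Y| + 1 <= #|K| by move: cK Eu cY; clear; lia.
  have [force _] := hcycle Y0 small.
  have /existsP[f /and3P[/injectiveP finj /eqP fK /forallP fe]] := isoK.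
  apply: (cycle_rainbow t0 force finj fK) => [i j|i iY].
    by have /forallP/(_ j)/eqP := fe i.
  by split; [apply/indF/(subsetP sYX)|apply: aY].
Qed.

(** Induction on the number of components in [P]. The size [#|X| + 1] is the invariant: it is
    restored after each removal and is the row sum in [assignment]. *)
Lemma rainbow_cover (P : {set {set T}}) X F : P \subset components e ->
  #|[set K in P | is_even_cycle e K]| <= 4 ->
  {in X, forall i, [/\ independent e (F i), F i \subset cover P & #|F i| = #|X|.+1]} ->
  rainbow_on e F X (cover P).
Proof.
have tcomp : trivIset (components e) by have /and3P[] := components_partition e_sym.
move: {2}#|P| (erefl #|P|) => n; elim: n P X F => [|n IHn] P X F cP sP evenP hF.
  move/eqP: cP; rewrite cards_eq0 => /eqP P0.
  have [->|[i iX]] := set_0Vmem X; first exact: rainbow_on0.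
  have [_ + cF] := hF i iX; rewrite P0 /cover big_set0 subset0 => /eqP F0.
  by move: cF; rewrite F0 cards0.
have tP := trivIsetS sP tcomp.
have indF : {in X, forall i, independent e (F i)} by move=> i /hF[].
have [/exists_inP[K KP ntK]|allt] := boolP [exists K in P, ~~ tight F X K].
  have Kc := subsetP sP K KP.
  have [Y sYX [rY restY]] := not_tight_removable indF Kc ntK.
  have [Ecov dis] := cover_setD1 tP KP.
  have sP' : P :\ K \subset components e by apply: subset_trans (subsetDl _ _) sP.
  (* A remaining set loses at most [#|Y|] of its [#|X| + 1] vertices, so enough are left for this
     cut. *)
  pose F' i := trunc #|X :\: Y|.+1 (F i :\: K).
  have F'D i : F' i \subset F i :\: K by apply: trunc_sub.
  have r' : rainbow_on e F' (X :\: Y) (cover (P :\ K)).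
    apply: IHn => //.
    - by have := cardsD1 K P; rewrite KP cP add1n => -[].
    - apply: leq_trans evenP; apply/subset_leq_card/subsetP=> L.
      by rewrite !inE => /andP[/andP[_ ->] ->].
    - move=> i iXY; have [iX iY] := setDP iXY; have [indFi sF cF] := hF i iX.
      split.
      + by apply: independent_sub indFi; apply: subset_trans (F'D i) (subsetDl _ _).
      + apply: subset_trans (F'D i) _; apply/subsetP=> x /setDP[xF xK].
        by have := subsetP sF x xF; rewrite Ecov inE (negbTE xK).
      + apply: card_trunc; have := restY i iXY; rewrite [#|F i :\: K|]cardsD cF (cardsDS sYX).
        by have := subset_leq_card sYX; clear; lia.
  rewrite Ecov.
  have -> : X = Y :|: (X :\: Y) by rewrite -{1}(setID X Y) (setIidPr sYX).
  apply: rainbow_onU => //.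
  - exact: component_closed.
  - exact: closed_cover.
  - by apply: rainbow_on_mono r' => // i _; rewrite setSI // (subset_trans (F'D i)) ?subsetDl.
have {}allt K : K \in P -> tight F X K.
  by move=> KP; apply: contraNT allt => h; apply/exists_inP; exists K.
(* All remaining components are tight, hence even cycles. *)
have cP4 : #|P| <= 4.
  apply: leq_trans evenP; apply/subset_leq_card/subsetP=> K KP.
  by rewrite inE KP; have /and3P[] := allt K KP.
have [K1 [K2 [K3 [K4 [hK Ecov d1 d2 d3]]]]] := cover_four tP cP4.
have col K : K \in [:: K1; K2; K3; K4] -> K = set0 \/ K \in components e /\ tight F X K.
  by move/hK=> [|KP]; [left|right; split; [apply: (subsetP sP)|apply: allt]].
have [|cl1 a1 n1 f1 r1] := @tight_column F X K1 indF.
  by apply: col; rewrite !inE eqxx ?orbT.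
have [|cl2 a2 n2 f2 r2] := @tight_column F X K2 indF.
  by apply: col; rewrite !inE eqxx ?orbT.
have [|cl3 a3 n3 f3 r3] := @tight_column F X K3 indF.
  by apply: col; rewrite !inE eqxx ?orbT.
have [|cl4 a4 n4 f4 r4] := @tight_column F X K4 indF.
  by apply: col; rewrite !inE eqxx ?orbT.
have [|||| Y1 [Y2 [Y3 [Y4 [sX [s1 s2] [s3 s4] [c1 c2 c3 c4] [b1 b2 b3 b4]]]]]] :=
  @assignment _ X (#|K1|./2).-1 (#|K2|./2).-1 (#|K3|./2).-1 (#|K4|./2).-1
   (fun i => #|F i :&: K1|) (fun i => #|F i :&: K2|) (fun i => #|F i :&: K3|)
   (fun i => #|F i :&: K4|).
- by move=> i iX; rewrite a1 ?a2 ?a3 ?a4.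
- move=> i iX; have [_ sF <-] := hF i iX.
  by rewrite -[in RHS](setIidPl sF) Ecov !card_setIU // !addnA.
- by [].
- by [].
rewrite Ecov; apply: (@rainbow_on_mono _ _ _ F F _ (Y1 :|: (Y2 :|: (Y3 :|: Y4)))).
- by rewrite !setUA.
- by [].
apply: rainbow_onU => //; [by do 2?apply: closed_setU| exact: r1|].
apply: rainbow_onU => //; [exact: closed_setU| exact: r2|].
by apply: rainbow_onU => //; [exact: r3| exact: r4].
Qed.

End Main.

(** * Lower and upper bounds for the rainbow number *)

Theorem theorem1p6
  (hcycle : forall m l : nat, 0 < m -> 2 * m + 1 <= l ->
     f_is (@cycle_graph l) m m m)
  (n : nat) (n_gt0 : 0 < n)
  (T : finType) (e : rel T) (e_sym : symmetric e) (e_irr : irreflexive e)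
  (hdeg : max_degree e <= 2)
  (hce : c_e e <= 4)
  (hind : exists A : {set T}, independent e A /\ #|A| = n) :
  f_is e n n.-1 n.-1.
Proof.
have [A [indA cA]] := hind; split; last first.
  (* Lower bound: [n - 1] representatives need [n - 1] distinct indices, so one constant collection
     suffices. *)
  move=> k /(_ (fun=> A)) [//|X [[m [i [x [imono xinj _ ->]]]] _ <-]].
  rewrite card_imset // card_ord -[k]card_ord -{1}(card_ord m).
  apply: (leq_card i) => a b E; apply/val_inj/eqP.
  by case: (ltngtP (val a) (val b)) => // h; have := imono _ _ h; rewrite E ltnn.
move=> F hF.
have /card_gt0P[t0 _] : 0 < #|A| by rewrite cA.
have deg2 x : #|[set y | e x y]| <= 2.
  exact: leq_trans (leq_bigmax (F := fun x => #|[set y | e x y]|) x) hdeg.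
(* With all [n - 1] indices and all components, the set size [n] is exactly the required
   [#|X| + 1]. *)
have [|i _|g [gF ginj gind]] :=
  @rainbow_cover hcycle T e t0 e_sym e_irr deg2 _ (components e) setT F (subxx _).
- exact: hce.
- have [indF cF] := hF i; rewrite (cover_partition (components_partition e_sym)).
  by split; rewrite ?subsetT // cF cardsT card_ord prednK.
exists [set g a | a : 'I_n.-1]; split.
- exists n.-1, id, g; split=> //.
  + by move=> a b; apply: ginj; rewrite inE.
  + by move=> a; have := gF a; rewrite inE => /(_ isT)/setIP[].
- by move=> _ _ /imsetP[a _ ->] /imsetP[b _ ->]; apply: gind; rewrite inE.
- by rewrite card_imset ?card_ord // => a b; apply: ginj; rewrite inE.
Qed.
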